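(* Let $G = AB$ be a finite group which is the product of the subgroups $A$ and $B$, and assume that $G$ is supersoluble. Suppose that every prime power order element $x\in A\cup B$ has square-free conjugacy class size $|x^G|$ in $G$. Then: (1) $G'$ is abelian. (2) The Sylow subgroups of $G'$ are elementary abelian. (3) $F(G)'$ has Sylow $p$-subgroups of order at most $p^2$, for every prime $p$.
   Context: $G=AB$ means that $A,B$ are subgroups of $G$ and $G=\{ab : a\in A,\ b\in B\}$. For $x\in G$, $x^G=\{g^{-1}xg : g\in G\}$ is its conjugacy class in $G$, and $|x^G|$ is its size. $G'$ is the derived subgroup of $G$, $F(G)$ is the Fitting subgroup of $G$ (largest nilpotent normal subgroup) and $F(G)'$ is its derived subgroup. A finite group is supersoluble if all its chief factors have prime order. The trivial group counts as elementary abelian. *)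

(* Defs.v *)
From mathcomp Require Import all_boot all_fingroup all_solvable.

Set Implicit Arguments.
Unset Strict Implicit.
Unset Printing Implicit Defensive.

Local Open Scope group_scope.

Definition squarefree (n : nat) : Prop :=
  forall d : nat, (d ^ 2 %| n)%N -> d = 1%N.

(* [chief_factor G V U] means that V is maximal among the normal subgroups of
   G properly contained in U, with U normal in G: U / V is a chief factor. *)
Definition supersoluble (gT : finGroupType) (G : {group gT}) : Prop :=
  forall V U : {group gT}, chief_factor G V U -> prime #|U / V|.

(* Main.v *)
(* Since G is supersoluble, G' is nilpotent, so for each prime p the quotient
   Q = G / O_p'(G) has a normal Sylow p-subgroup S containing Q'; the Sylow
   p-subgroups of G' and F(G)' embed in Q' and S', and the hypothesis on class
   sizes passes to Q. For x in A or B of prime power order, C_S(x) has index at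
   most p in S, hence contains Phi(S), and Phi(S) <= Z(Q). If moreover x is a
   p'-element, [S, x] has order at most p and is central in S. Thus S is central
   modulo Z = Omega_1(Z(S)), and Schur-Zassenhaus makes Q / Z abelian: Q' <= Z is
   elementary abelian. Finally S = (S :&: A)(S :&: B) has class at most two, and
   each [S :&: A, S], [S :&: B, S] has order at most p, since the commutator maps
   of elements of the factors have rank at most one. *)

Require Import Defs.
From mathcomp Require Import all_boot all_fingroup all_solvable.

Set Implicit Arguments.
Unset Strict Implicit.
Unset Printing Implicit Defensive.

Local Open Scope group_scope.

(** * Nilpotency of the derived subgroup of a supersoluble group *)

(** A group of prime order is cyclic, so its automorphism group is abelian and G' acts trivially on
    [U / V]. *)
Lemma chief_factor_prime_der1 (gT : finGroupType) (G V U : {group gT}) :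
  chief_factor G V U -> prime #|U / V| -> [~: U, G^`(1)] \subset V.
Proof.
move=> /andP[maxV nsUG] prUV; have [sUG nUG] := andP nsUG.
have /andP[_ nVG] := maxgroupp maxV.
have sG'G := der_sub 1 G.
rewrite -quotient_cents2 ?(subset_trans sUG) ?(subset_trans sG'G) // centsC.
have nUVG : G / V \subset 'N(U / V) by rewrite quotient_norms.
rewrite quotient_der // -ker_conj_aut ker_trivg_morphim.
rewrite (subset_trans (der_sub 1 _)) //= morphim_der //.
have abAut : abelian (conj_aut (U / V) @* (G / V)).
  by rewrite (abelianS (Aut_conj_aut _ _)) ?Aut_cyclic_abelian ?prime_cyclic.
by rewrite (derG1P abAut).
Qed.

Lemma supersoluble_der1_nilpotent (gT : finGroupType) (G : {group gT}) :
  supersoluble G -> nilpotent G^`(1).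
Proof.
(* Nilpotency is tested on a subgroup [K] of G' with [K] inside [K, G']: such a [K] slides down a
   chief series of [G], one factor at a time, to the trivial group. *)
move=> superG; apply/forallP=> K; apply/implyP.
rewrite subsetI => /andP[sKG' sK].
have [s ch_s lastG] := chief_series_exists (normal_refl G).
have: K \subset last 1%G s by rewrite lastG (subset_trans sKG') ?der_sub.
elim/last_ind: s ch_s {lastG} => [|s U IHs]; first by rewrite /= subG1.
rewrite rcons_path last_rcons => /andP[ch_s chU] sKU; apply: IHs => //.
apply: subset_trans sK (subset_trans (commSg _ sKU) _).
exact: chief_factor_prime_der1 chU (superG _ _ chU).
Qed.

(** * Passing to the quotient by the pi'-core *)

(** The nilpotent [K] is the product of its pi-core and its pi'-core; the latter is characteristic
    in [K], hence killed in the quotient. *)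
Lemma quotient_pcoreC_pgroup (gT : finGroupType) (pi : nat_pred)
    (G K : {group gT}) :
  K <| G -> nilpotent K -> pi.-group (K / 'O_pi^'(G)).
Proof.
move=> nsKG nilK; have /dprodP[_ defK _ _] := nilpotent_pcoreC pi nilK.
have sK'N : 'O_pi^'(K) \subset 'O_pi^'(G).
  by rewrite pcore_max ?pcore_pgroup // gFnormal_trans.
have nNK : K \subset 'N('O_pi^'(G)).
  by rewrite (subset_trans (normal_sub nsKG)) ?gFnorm.
rewrite -{1}defK quotientMl ?(subset_trans (pcore_sub _ _)) //.
by rewrite (quotientS1 sK'N) mulg1 quotient_pgroup ?pcore_pgroup.
Qed.

Lemma quotient_class_dvdn (gT : finGroupType) (G N : {group gT}) (x : gT) :
  N <| G -> x \in G -> #|coset N x ^: (G / N)| %| #|x ^: G|.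
Proof.
move=> /andP[sNG nNG] Gx; rewrite -!index_cent1.
have nCN : G :&: 'C_G[x] \subset 'N(N) by rewrite subIset ?nNG.
apply: dvdn_trans (index_quotient nCN).
have sCx : 'C_G[x] / N \subset 'C_(G / N)[coset N x].
  by apply: morphim_subcent1; apply: subsetP Gx.
by rewrite -(Lagrange_index (subsetIl _ _) sCx) dvdn_mulr.
Qed.

Lemma pgroup_card_le_prime (gT : finGroupType) (p : nat) (D : {group gT}) :
  prime p -> p.-group D -> (#|D| <= p)%N -> D :!=: 1 -> #|D| = p.
Proof.
move=> p_pr pD leDp ntD; apply/eqP; rewrite eqn_leq leDp dvdn_leq //.
by have [] := pgroup_pdiv pD ntD.
Qed.

(** * Commutator maps in p-groups of class at most two *)

Section ClassTwo.

Variables (gT : finGroupType) (P : {group gT}).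
Hypothesis cl2 : P^`(1) \subset 'Z(P).

(* In class at most two, [y |-> [~ x, y]] is a homomorphism, so its image
   [x^-1 *: x ^: P] is already a subgroup. *)
Definition commg_image (x : gT) := <<x^-1 *: x ^: P>>.

Canonical commg_image_group x := Eval hnf in [group of commg_image x].

Lemma commg_central x y : x \in P -> y \in P ->
  {in P, forall z, commute [~ x, y] z}.
Proof.
move=> Px Py; have /(subsetP cl2) : [~ x, y] \in P^`(1) by rewrite mem_commg.
by case/centerP.
Qed.

Lemma commg_imageE x : x \in P -> commg_image x = x^-1 *: x ^: P.
Proof.
move=> Px; apply/gen_set_id/group_setP; split.
  by rewrite mem_lcoset invgK mulg1 class_refl.
move=> _ _ /lcosetP[_ /imsetP[y Py ->] ->] /lcosetP[_ /imsetP[z Pz ->] ->].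
rewrite mem_lcoset invgK; apply/imsetP; exists (z * y); first exact: groupM.
apply: (mulgI x^-1); rewrite mulKg -!commgEl commgMJ; congr (_ * _).
by rewrite conjgE commg_central // mulKg.
Qed.

Lemma card_commg_image x : x \in P -> #|commg_image x| = #|x ^: P|.
Proof. by move=> Px; rewrite commg_imageE // card_lcoset. Qed.

Lemma commg_imageP x z : x \in P ->
  reflect (exists2 y, y \in P & z = [~ x, y]) (z \in commg_image x).
Proof.
move=> Px; rewrite commg_imageE //.
apply: (iffP lcosetP) => [[_ /imsetP[y Py ->] ->] | [y Py ->]].
  by exists y.
by exists (x ^ y); rewrite ?imset_f.
Qed.

Lemma mem_commg_image x y : x \in P -> y \in P -> [~ x, y] \in commg_image x.
Proof. by move=> Px Py; apply/commg_imageP=> //; exists y. Qed.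

Lemma commg_image_sub x : x \in P -> commg_image x \subset P.
Proof.
move=> Px; apply/subsetP=> _ /commg_imageP[] // y Py ->.
by rewrite groupR.
Qed.

Lemma subcent1_commg x y : y \in P -> (y \in 'C_P[x]) = ([~ x, y] == 1).
Proof. by move=> Py; rewrite inE Py cent1E; apply/eqP/commgP. Qed.

Variable p : nat.
Hypotheses (p_pr : prime p) (pP : p.-group P).

Lemma card_commg_image_prime x : x \in P -> (#|x ^: P| <= p)%N ->
  commg_image x != 1 -> #|commg_image x| = p.
Proof.
move=> Px; rewrite -card_commg_image //; apply: pgroup_card_le_prime => //.
exact: pgroupS (commg_image_sub Px) pP.
Qed.

(** By contraposition: if [g] centralises [x] but not [y], then [[~ x * y, g] = [~ y, g]] is a
    nontrivial element common to the images of [x * y] and [y]. Having order at most [p], these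
    coincide, and so contain every [[~ x, h]]. *)
Lemma commg_image_nsub x y : x \in P -> y \in P ->
    (#|x ^: P| <= p)%N -> (#|y ^: P| <= p)%N -> (#|(x * y) ^: P| <= p)%N ->
  ~~ (commg_image x \subset commg_image y) -> 'C_P[x] \subset 'C_P[y].
Proof.
move=> Px Py px py pxy; apply: contraR => /subsetPn[g]; rewrite inE => /andP[Pg].
rewrite cent1C => /cent1P/commgP/eqP cxg; rewrite subcent1_commg // => ntyg.
have Pxy := groupM Px Py.
have eqyg : [~ x * y, g] = [~ y, g].
  by rewrite commMgJ cxg conj1g mul1g.
have oy : #|commg_image y| = p.
  apply: card_commg_image_prime => //; apply/trivgPn; exists [~ y, g] => //.
  exact: mem_commg_image.
have sy_xy : commg_image y \subset commg_image (x * y).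
  apply: contraR ntyg => /prime_TIg TI; rewrite -in_set1 -[[set 1]]TI ?oy //.
  by rewrite inE mem_commg_image // -eqyg mem_commg_image.
have eq_xy : commg_image y = commg_image (x * y).
  by apply/eqP; rewrite eqEcard sy_xy oy card_commg_image.
apply/subsetP=> _ /commg_imageP[] // h Ph ->.
have: [~ x * y, h] \in commg_image y by rewrite eq_xy mem_commg_image.
rewrite commMgJ groupMr ?mem_commg_image // conjgE commg_central //.
by rewrite mulKg.
Qed.

(* A space of linear maps of rank at most one has a common image line or a
   common kernel hyperplane [H]; in the second case any [v] in [A :|: B]
   outside [H] has [[~: A, P] = [~: A, <[v]>]], again inside a line. *)
Lemma card_commg_factor (A B : {group gT}) : A * B = P ->
    {in A :|: B, forall x, #|x ^: P| <= p}%N ->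
  (#|[~: A, P]| <= p)%N.
Proof.
move=> defP pAB.
have sAP : A \subset P by rewrite -defP mulG_subl.
have sBP : B \subset P by rewrite -defP mulG_subr.
have PA x : x \in A -> x \in P by apply: subsetP.
have pA x : x \in A -> (#|x ^: P| <= p)%N by move=> Ax; rewrite pAB ?inE ?Ax.
pose D := commg_image.
suffices [v [Pv pv sv]]: exists v, [/\ v \in P, (#|v ^: P| <= p)%N
    & {in A, forall x, D x \subset D v}].
  rewrite (leq_trans _ pv) // -card_commg_image // subset_leq_card //.
  rewrite gen_subG; apply/subsetP=> _ /imset2P[x y Ax Py ->].
  by rewrite (subsetP (sv x Ax)) // mem_commg_image // PA.
case: (boolP [exists x in A, exists y in A,
                  ~~ (D x \subset D y) && ~~ (D y \subset D x)]).
  case/exists_inP=> x Ax /exists_inP[y Ay /andP[nDxy nDyx]].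
  have nsub z t : z \in A -> t \in A -> ~~ (D z \subset D t) ->
    'C_P[z] \subset 'C_P[t].
    by move=> Az At; apply: commg_image_nsub; rewrite ?PA ?pA ?groupM.
  have Dp z t : z \in A -> ~~ (D z \subset D t) -> #|D z| = p.
    move=> Az; apply: contraNeq => /eqP nDzp.
    suffices /eqP-> : D z == 1 by rewrite sub1G.
    apply/idPn=> ntDz; case: nDzp.
    by rewrite [#|_|]card_commg_image_prime ?PA ?pA.
  have eqCxy : 'C_P[x] = 'C_P[y] by apply/eqP; rewrite eqEsubset !nsub.
  have not_both z : (#|D z| <= p)%N -> D x \subset D z -> D y \subset D z ->
    False.
    move=> leDz sxz syz; case/negP: nDyx.
    suffices -> : D x = D z by [].
    by apply/eqP; rewrite eqEcard sxz (Dp _ _ Ax nDxy).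
  (* [D z] has order at most [p], so it cannot contain both [D x] and [D y]; [nsub] applies to one
     that it misses, and both have the same centraliser. *)
  have cHA z : z \in A -> 'C_P[x] \subset 'C_P[z].
    move=> Az; case: (boolP (D x \subset D z)) => [sxz|]; last exact: nsub.
    rewrite eqCxy nsub //; apply/negP; apply: not_both => //.
    by rewrite /D card_commg_image ?PA ?pA.
  have iH : #|P : 'C_P[x]| = p.
    by rewrite index_cent1 -card_commg_image ?PA //; apply: Dp nDxy.
  have maxH : maximal 'C_P[x] P by rewrite p_index_maximal ?subsetIl ?iH.
  (* If [A] and [B] both lay in ['C_P[x]], so would [P], against index [p]. *)
  have [v ABv nHv] : exists2 v, v \in A :|: B & v \notin 'C_P[x].
    apply/subsetPn; rewrite subUset; apply: contraL p_pr => /andP[sAH sBH].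
    by rewrite -iH (_ : 'C_P[x] = P) ?indexgg //; apply/eqP;
      rewrite eqEsubset subsetIl -{1}defP mul_subG.
  have Pv : v \in P by case/setUP: ABv; apply: subsetP.
  exists v; split=> [//||z]; first exact: pAB.
  move=> Az; apply/subsetP=> _ /commg_imageP[|g Pg ->]; first exact: PA.
  have defHv : 'C_P[x] * <[v]> = P.
    by rewrite (mulg_normal_maximal (p_maximal_normal pP maxH)) ?cycle_subG.
  (* With [h] centralising [z], only [[~ z, v ^+ i]] survives, the inverse of [[~ v, z] ^+ i]. *)
  move: Pg; rewrite -defHv => /mulsgP[h _ Hh /cycleP[i ->] ->].
  have /setIP[Ph] := subsetP (cHA z Az) h Hh.
  rewrite cent1C => /cent1P/commgP/eqP czh.
  rewrite commgMJ czh conj1g mulg1 -groupV invg_comm.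
  rewrite commXg; last first.
    by apply: commute_sym; apply: commg_central; rewrite ?(PA z).
  by rewrite groupX // mem_commg_image ?(PA z).
move/exists_inPn=> cmpA.
(* Any two images are now comparable, so one of maximal order contains all others. *)
have [v Av maxv] : {v | v \in A & forall x, x \in A -> (#|D x| <= #|D v|)%N}.
  by case: (arg_maxnP (fun x => #|D x|) (group1 A)) => v Av maxv; exists v.
exists v; split=> [||x Ax]; rewrite ?PA ?pA //.
have := exists_inPn (cmpA v Av) x Ax; rewrite negb_and !negbK orbC.
case/orP=> [//|svx].
suffices -> : D x = D v by [].
by apply/esym/eqP; rewrite eqEcard svx maxv.
Qed.

Lemma card_der1_factor (A B : {group gT}) : A * B = P ->
    {in A :|: B, forall x, #|x ^: P| <= p}%N ->
  (#|P^`(1)| <= p ^ 2)%N.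
Proof.
move=> defP pAB.
have sAP : A \subset P by rewrite -defP mulG_subl.
have sBP : B \subset P by rewrite -defP mulG_subr.
have derP : P^`(1) = [~: A, P] * [~: B, P].
  rewrite derg1 -{1}defP commMG // (subset_trans sBP) //.
  by rewrite commg_normr.
have defP' : B * A = P by rewrite -invMG defP invGid.
have pBA : {in B :|: A, forall x, #|x ^: P| <= p}%N by rewrite setUC.
rewrite -mulnn derP.
apply: leq_trans (_ : _ <= #|[~: A, P]| * #|[~: B, P]|)%N _.
  by rewrite dvdn_leq ?muln_gt0 ?cardG_gt0 // dvdn_cardMg.
apply: leq_mul; first exact: card_commg_factor defP pAB.
exact: card_commg_factor defP' pBA.
Qed.

End ClassTwo.

(** * Prime power elements and Sylow subgroups *)

(** Sylow subgroups generate [A]. This reduces containments to the elements whose class sizes are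
    controlled. *)
Lemma sub_primary_gen (gT : finGroupType) (A K : {group gT}) :
    (forall (q : nat) (x : gT), prime q -> x \in A -> q.-elt x -> x \in K) ->
  A \subset K.
Proof.
move=> sAK; rewrite -(Sylow_gen A) gen_subG; apply/bigcupsP=> P.
case/andP=> /p_groupP[q q_pr qP] /andP[sPA _]; apply/subsetP=> x Px.
by apply: (sAK q) => //; [apply: subsetP Px | apply: mem_p_elt Px].
Qed.

Lemma pgroup_der1_Sylow (gT : finGroupType) (p : nat) (G : {group gT}) :
  p.-group G^`(1) -> p.-Sylow(G) 'O_p(G).
Proof.
move=> pG'; have [S sylS] := Sylow_exists p G; have sSG := pHall_sub sylS.
have sG'S : G^`(1) \subset S.
  apply: subset_trans (pcore_max pG' (der_normal 1 G)) _.
  exact: pcore_sub_Hall sylS.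
by rewrite (normal_Hall_pcore sylS) // sub_der1_normal.
Qed.

(** As [S] is normal, ['C_S[x]] is a Sylow subgroup of ['C_G[x]]. *)
Lemma index_subcent1_Sylow (gT : finGroupType) (p : nat) (G S : {group gT}) x :
  p.-Sylow(G) S -> S <| G -> x \in G -> #|S : 'C_S[x]| = (#|x ^: G|`_p)%N.
Proof.
move=> sylS nsSG Gx; rewrite -index_cent1.
have sCG : 'C_G[x] \subset G := subsetIl _ _.
have := card_Hall (setI_normal_Hall nsSG sylS sCG).
rewrite /= setIA (setIidPl (normal_sub nsSG)) => oC.
apply/eqP; rewrite -(eqn_pmul2l (cardG_gt0 'C_S[x])) Lagrange ?subsetIl //.
by rewrite oC -partnM ?cardG_gt0 ?indexg_gt0 // Lagrange // (card_Hall sylS).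
Qed.

Lemma leq_part_prime (p n : nat) : prime p -> (0 < n)%N -> ~~ (p ^ 2 %| n) ->
  (n`_p <= p)%N.
Proof.
move=> p_pr n_gt0; rewrite pfactor_dvdn // -ltnNge ltnS => le1.
by rewrite p_part -[leqRHS]expn1 leq_pexp2l ?prime_gt0.
Qed.

(** * Action of a single element on a normal Sylow subgroup *)

Section NormalSylow.

Variables (gT : finGroupType) (p : nat) (G S : {group gT}).
Hypotheses (p_pr : prime p) (sylS : p.-Sylow(G) S) (nsSG : S <| G).

Let pS : p.-group S := pHall_pgroup sylS.
Let sSG : S \subset G := normal_sub nsSG.

Lemma index_subcent1_leq x : x \in G -> ~~ (p ^ 2 %| #|x ^: G|) ->
  (#|S : 'C_S[x]| <= p)%N.
Proof.
move=> Gx psq; rewrite (index_subcent1_Sylow sylS) //.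
by rewrite leq_part_prime // -index_cent1.
Qed.

Lemma subcent1_prime_index x : x \in G -> ~~ (p ^ 2 %| #|x ^: G|) ->
  'C_S[x] != S -> #|S : 'C_S[x]| = p.
Proof.
move=> Gx psq neCS; apply/eqP; rewrite eqn_leq index_subcent1_leq //.
have /p_natP[k oC] : p.-nat #|S : 'C_S[x]| := pnat_dvd (dvdn_indexg _ _) pS.
rewrite oC; case: k oC => [oC|k _]; last first.
  by rewrite expnS leq_pmulr ?expn_gt0 ?prime_gt0.
case/eqP: neCS; apply/eqP; rewrite eqEsubset subsetIl.
by rewrite -indexg_eq1 oC.
Qed.

Lemma subcent1_maximal x : x \in G -> ~~ (p ^ 2 %| #|x ^: G|) ->
  'C_S[x] != S -> maximal 'C_S[x] S.
Proof.
by move=> Gx psq neCS; rewrite p_index_maximal ?subsetIl ?subcent1_prime_index.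
Qed.

Lemma cent1_Phi x : x \in G -> ~~ (p ^ 2 %| #|x ^: G|) -> x \in 'C('Phi(S)).
Proof.
move=> Gx psq; rewrite -sub_cent1.
suffices: 'Phi(S) \subset 'C_S[x] by rewrite subsetI => /andP[].
have [-> | neCS] := eqVneq 'C_S[x] S; first exact: Phi_sub.
exact/Phi_sub_max/subcent1_maximal.
Qed.

(** Put T = [S, x] and C = C_S(x), of index 1 or [p]. In the second case S = TC and C centralises T,
    so T modulo its centre is cyclic and T is abelian; coprime action then gives C_T(x) = 1, whence
    T has order [p] and is central. *)
Lemma commg_p'elt_central x : x \in G -> ~~ (p ^ 2 %| #|x ^: G|) ->
  p^'.-elt x -> [~: S, <[x]>] \subset 'Ohm_1('Z(S)).
Proof.
move=> Gx psq p'x.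
set T := [~: S, <[x]>]; set C := 'C_S[x].
have defC : C = 'C_S(<[x]>) by rewrite cent_cycle.
have nSx : <[x]> \subset 'N(S).
  by rewrite cycle_subG (subsetP (normal_norm nsSG)).
have coSx : coprime #|S| #|<[x]>| := pnat_coprime pS p'x.
have [eqCS | neCS] := eqVneq C S.
  rewrite (_ : T = 1) ?sub1G //; apply/commG1P.
  by rewrite -eqCS defC subsetIr.
have oC : #|S : C| = p := subcent1_prime_index Gx psq neCS.
have maxC : maximal C S := subcent1_maximal Gx psq neCS.
have nsCS : C <| S := p_maximal_normal pS maxC.
have sTS : T \subset S by rewrite commg_subl.
have cCx : [~: C, <[x]>] = 1 by apply/commG1P; rewrite defC subsetIr.
have cCT : C \subset 'C(T).
  (* The remaining hypothesis [C, S, x] = 1 holds because [C], being maximal, is normal in [S]. *)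
  rewrite centsC; apply/commG1P/three_subgroup.
    by rewrite (commGC <[x]>) cCx comm1G.
  apply/trivgP; rewrite -cCx commSg // commg_subl.
  exact: normal_norm.
have nTS : S \subset 'N(T) by rewrite commg_norml.
have nTx : <[x]> \subset 'N(T) by rewrite commg_normr.
(* The element [x] acts trivially on S / T, and by coprimeness its fixed points there lift to
   [C]. *)
have defS : T * C = S.
  apply/eqP; rewrite eqEsubset mul_subG ?subsetIl //=.
  rewrite -quotientSK // defC coprime_quotient_cent ?(pgroup_sol pS) //.
  by rewrite subsetI subxx quotient_cents2 ?subxx.
have defT : [~: T, <[x]>] = T.
  have cTx : C \subset 'N([~: T, <[x]>]).
    apply: normsR; first exact: cents_norm.
    by apply: cents_norm; rewrite defC subsetIr.
  by rewrite {2}/T -defS commMG // cCx mulg1.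
have oTC : #|T : T :&: C| = p.
  apply/eqP; rewrite indexgI -(eqn_pmul2r (cardG_gt0 C)) LagrangeMr defS -oC.
  by rewrite mulnC Lagrange ?subsetIl.
have sTCZ : T :&: C \subset 'Z(T).
  by rewrite subsetI subsetIl subIset ?cCT ?orbT.
have abT : abelian T.
  apply: cyclic_center_factor_abelian.
  have: #|T / 'Z(T)| %| p.
    rewrite card_quotient ?gFnorm // -oTC -(Lagrange_index (center_sub T) sTCZ).
    exact: dvdn_mulr.
  case/(proj2 (primeP p_pr))/pred2P=> [/card1_trivg-> | oTZ].
    exact: cyclic1.
  by rewrite prime_cyclic ?oTZ.
have TI : 'C_T(<[x]>) = 1.
  rewrite -defT coprime_abel_cent_TI //.
  by apply: coprimeSg coSx.
have oT : #|T| = p.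
  rewrite -oTC; suffices -> : T :&: C = 1 by rewrite indexg1.
  by rewrite defC setIA (setIidPl sTS) TI.
have sTZ : T \subset 'Z(S).
  by rewrite subsetI sTS -defS centM subsetI [T \subset 'C(T)]abT centsC.
have pT : p.-group T := pgroupS sTS pS.
rewrite (OhmE _ (pgroupS (center_sub _) pS)) sub_gen //.
apply/subsetP=> t Tt; apply/LdivP; split; first exact: subsetP Tt.
apply/eqP; rewrite expn1 -order_dvdn -oT order_dvdG //.
Qed.

End NormalSylow.

(** Commutators are central, and so are p-th powers; hence [[~ x, y] ^+ p = [~ x ^+ p, y] = 1]. *)
Lemma Phi_central_der1_Ohm (gT : finGroupType) (p : nat) (S : {group gT}) :
  p.-group S -> 'Phi(S) \subset 'Z(S) -> S^`(1) \subset 'Ohm_1('Z(S)).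
Proof.
move=> pS sPhiZ; have defPhi := Phi_joing pS.
have sS'Z : S^`(1) \subset 'Z(S).
  by apply: subset_trans sPhiZ; rewrite defPhi joing_subl.
rewrite (OhmE _ (pgroupS (center_sub _) pS)) gen_subG.
apply/subsetP=> _ /imset2P[x y Sx Sy ->]; apply: mem_gen; apply/LdivP.
have Zxy : [~ x, y] \in 'Z(S) by rewrite (subsetP sS'Z) ?mem_commg.
split=> //; rewrite -commXg; last first.
  by apply/commute_sym; case/centerP: Zxy => _; apply.
apply/eqP/commgP; have: x ^+ (p ^ 1) \in 'Z(S).
  rewrite (subsetP sPhiZ) // defPhi mem_gen // inE orbC Mho_p_elt //.
  exact: mem_p_elt Sx.
by case/centerP=> _; apply.
Qed.

(** * Factorised groups with a normal Sylow subgroup *)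

Section Factorised.

Variables (gT : finGroupType) (p : nat) (G S A B : {group gT}).
Hypotheses (p_pr : prime p) (sylS : p.-Sylow(G) S) (nsSG : S <| G).
Hypothesis defG : A * B = G :> {set gT}.
Hypothesis sqAB : forall (q : nat) (x : gT), prime q -> x \in A :|: B ->
  q.-elt x -> ~~ (p ^ 2 %| #|x ^: G|).

Let pS : p.-group S := pHall_pgroup sylS.
Let sSG : S \subset G := normal_sub nsSG.
Let sAG : A \subset G. Proof. by rewrite -defG mulG_subl. Qed.
Let sBG : B \subset G. Proof. by rewrite -defG mulG_subr. Qed.
Let sABG : A :|: B \subset G. Proof. by rewrite subUset sAG sBG. Qed.

Lemma factor_sub_primary (K : {group gT}) :
    (forall (q : nat) (x : gT), prime q -> x \in A :|: B -> q.-elt x ->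
      x \in K) ->
  G \subset K.
Proof.
move=> sABK; rewrite -defG mul_subG //; apply: sub_primary_gen => q x q_pr xAB;
  by apply: sABK; rewrite // inE xAB ?orbT.
Qed.

Lemma factor_cent_Phi : G \subset 'C('Phi(S)).
Proof.
apply: factor_sub_primary => q x q_pr ABx qx.
by apply: (cent1_Phi p_pr sylS nsSG); rewrite ?(subsetP sABG) ?(sqAB q_pr).
Qed.

Lemma Phi_Sylow_central : 'Phi(S) \subset 'Z(S).
Proof.
by rewrite subsetI Phi_sub centsC (subset_trans sSG factor_cent_Phi).
Qed.

Lemma der1_sub_Ohm_center : G^`(1) \subset S -> G^`(1) \subset 'Ohm_1('Z(S)).
Proof.
move=> sG'S; set Z := 'Ohm_1('Z(S)).
have nsZG : Z <| G by rewrite !gFnormal_trans.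
have [sZG nZG] := andP nsZG; have nZS := subset_trans sSG nZG.
have cSG : G / Z \subset 'C(S / Z).
  suffices sGK : G \subset coset Z @*^-1 'C(S / Z) by rewrite sub_quotient_pre.
  apply: factor_sub_primary => q x q_pr ABx qx.
  have Gx := subsetP sABG x ABx; have psq := sqAB q_pr ABx qx.
  rewrite -cycle_subG -sub_quotient_pre ?cycle_subG ?(subsetP nZG) //.
  rewrite quotient_cents2r // commGC.
  (* A p'-element has its commutators with [S] in [Z] by coprime action; a p-element lies in [S],
     and S' is inside [Z]. *)
  have [eqqp | neqqp] := eqVneq q p; last first.
    apply: (commg_p'elt_central p_pr sylS nsSG) => //.
    by apply: sub_in_pnat qx => r _ /eqnP->; rewrite !inE.
  apply: subset_trans (Phi_central_der1_Ohm pS Phi_Sylow_central).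
  rewrite commgS // cycle_subG (mem_normal_Hall sylS nsSG) //.
  by rewrite -eqqp.
have /splitsP[H /complP[tiSH defSH]] :=
  SchurZassenhaus_split (pHall_Hall sylS) nsSG.
have sHG : H \subset G by rewrite -defSH mulG_subr.
(* H' lies in both [H] and G', which is inside [S], so it is trivial. *)
have abH : abelian H.
  apply/derG1P/trivgP; rewrite -tiSH subsetI der_sub andbT.
  by rewrite (subset_trans _ sG'S) ?dergS.
have abG : abelian (G / Z).
  have abSZ : abelian (S / Z) := subset_trans (quotientS Z sSG) cSG.
  rewrite -defSH quotientMl // abelianM abSZ quotient_abelian //=.
  exact: subset_trans (quotientS Z sHG) cSG.
exact: der1_min.
Qed.

Lemma card_der1_Sylow : (#|S^`(1)| <= p ^ 2)%N.
Proof.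
(* Intersections with the normal Sylow subgroup are Sylow in [A], [B] and their intersection, so
   taking p-parts in |A||B| = |AB||A :&: B| gives the order of the product. *)
have defS : (S :&: A) * (S :&: B) = S.
  have oSI (K : {group gT}) : K \subset G -> #|S :&: K| = (#|K|`_p)%N.
    by move=> sKG; rewrite (card_Hall (setI_normal_Hall nsSG sylS sKG)).
  apply/eqP; rewrite eqEcard mul_subG ?subsetIl //=.
  have := mul_cardG (S :&: A) (S :&: B); rewrite /= -setIIr => oSAB.
  rewrite -(leq_pmul2r (cardG_gt0 (S :&: (A :&: B)))) -oSAB /=.
  rewrite !oSI ?subIset ?sAG // (card_Hall sylS) -!partnM ?cardG_gt0 //.
  by rewrite [(#|A| * _)%N]mul_cardG defG.
have S'Z : S^`(1) \subset 'Z(S).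
  by rewrite (subset_trans _ Phi_Sylow_central) // (Phi_joing pS) joing_subl.
apply: (card_der1_factor S'Z p_pr pS defS) => x; rewrite -setIUr.
case/setIP=> Sx ABx; rewrite -index_cent1.
apply: (index_subcent1_leq p_pr sylS nsSG); first exact: subsetP Sx.
exact: sqAB p_pr ABx (mem_p_elt pS Sx).
Qed.

End Factorised.

(** * Transfer from the quotients back to [G] *)

Lemma quotient_p'core_isog (gT : finGroupType) (p : nat) (G P : {group gT}) :
  P \subset G -> p.-group P -> P \isog P / 'O_p^'(G).
Proof.
move=> sPG pP; apply: quotient_isog.
  by rewrite (subset_trans sPG) ?gFnorm.
by apply: coprime_TIg; rewrite coprime_sym (pnat_coprime pP (pcore_pgroup _ _)).
Qed.

Theorem theoremD (gT : finGroupType) (G A B : {group gT})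
    (defG : A * B = G :> {set gT})
    (superG : supersoluble G)
    (sqfG : forall (p : nat) (x : gT), prime p -> x \in A :|: B ->
      p.-elt x -> squarefree #|x ^: G|) :
  [/\ abelian G^`(1),
      forall (p : nat) (P : {group gT}), prime p ->
        p.-Sylow(G^`(1)) P -> p.-abelem P
    & forall (p : nat) (P : {group gT}), prime p ->
        p.-Sylow('F(G)^`(1)) P -> (#|P| <= p ^ 2)%N].
Proof.
have nilG' := supersoluble_der1_nilpotent superG.
have nNG (p : nat) : 'O_p^'(G) <| G := pcore_normal _ G.
have sAG : A \subset G by rewrite -defG mulG_subl.
have sBG : B \subset G by rewrite -defG mulG_subr.
have pQ' (p : nat) : p.-group (G / 'O_p^'(G))^`(1).
  rewrite -quotient_der ?gFnorm //; apply: quotient_pcoreC_pgroup => //.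
  exact: der_normal.
have sylS (p : nat) := pgroup_der1_Sylow (pQ' p).
have defQ (p : nat) : (A / 'O_p^'(G)) * (B / 'O_p^'(G)) = G / 'O_p^'(G).
  by rewrite -quotientMl ?defG // (subset_trans sAG) ?gFnorm.
have sqQ (p : nat) : prime p -> forall (q : nat) xbar, prime q ->
    xbar \in A / 'O_p^'(G) :|: B / 'O_p^'(G) -> q.-elt xbar ->
  ~~ (p ^ 2 %| #|xbar ^: (G / 'O_p^'(G))|).
  move=> p_pr q xbar q_pr; rewrite -quotientU => /morphimP[x Nx ABx ->] qx.
  have Gx : x \in G by case/setUP: ABx; apply: subsetP.
  (* The lift [x] need not be a q-element; its q-part has the same image and, being a power of [x],
     stays in the same factor. *)
  rewrite -(constt_p_elt qx) -morph_constt //.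
  have ABxq : x.`_q \in A :|: B.
    by case/setUP: ABx => ?; apply/setUP; [left | right]; apply: groupX.
  apply/negP=> /dvdn_trans/(_ (quotient_class_dvdn (nNG p) (groupX _ Gx))) psq.
  by move: p_pr; rewrite (sqfG q _ q_pr ABxq (p_elt_constt _ _) p psq).
have abelQ' (p : nat) : prime p -> p.-abelem (G / 'O_p^'(G))^`(1).
  move=> p_pr; have pS := pHall_pgroup (sylS p).
  apply: abelemS (Ohm1_abelem (pgroupS (center_sub _) pS) (center_abelian _)).
  apply: der1_sub_Ohm_center p_pr (sylS p) (pcore_normal _ _) (defQ p)
           (sqQ p p_pr) _.
  exact: pcore_max (pQ' p) (der_normal _ _).
split=> [|p P p_pr sylP|p P p_pr sylP].
- apply/derG1P/eqP; rewrite trivg_card1; apply/negPn/negP => ntG''.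
  (* For a prime [p] dividing the order of G'', the quotient by the p'-core has abelian derived
     subgroup, so G'' is a p'-group: a contradiction. *)
  have p_pr : prime (pdiv #|G^`(1)^`(1)|).
    by rewrite pdiv_prime // ltn_neqAle eq_sym ntG'' cardG_gt0.
  set p := pdiv _ in p_pr.
  have sG''N : G^`(1)^`(1) \subset 'O_p^'(G).
    have nG'N : G^`(1) \subset 'N('O_p^'(G)).
      by rewrite (subset_trans (der_sub 1 G)) ?gFnorm.
    rewrite -quotient_sub1; last exact: subset_trans (der_sub 1 _) nG'N.
    rewrite quotient_der // quotient_der ?gFnorm //.
    by have /derG1P/= -> := abelem_abelian (abelQ' p p_pr).
  have := pgroupS sG''N (pcore_pgroup _ _).
  by rewrite /pgroup p'natE // pdiv_dvd.
- have sPG := subset_trans (pHall_sub sylP) (der_sub 1 G).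
  rewrite (isog_abelem (quotient_p'core_isog sPG (pHall_pgroup sylP))).
  apply: abelemS (abelQ' p p_pr).
  by rewrite /= -quotient_der ?gFnorm // quotientS ?(pHall_sub sylP).
have sF'G : 'F(G)^`(1) \subset G := subset_trans (der_sub 1 _) (Fitting_sub G).
have sPG := subset_trans (pHall_sub sylP) sF'G.
rewrite (card_isog (quotient_p'core_isog sPG (pHall_pgroup sylP))).
apply: leq_trans (card_der1_Sylow p_pr (sylS p) (pcore_normal _ _) (defQ p)
                    (sqQ p p_pr)).
apply/subset_leq_card/(subset_trans (quotientS _ (pHall_sub sylP))).
rewrite /= quotient_der ?(subset_trans (Fitting_sub G)) ?gFnorm // dergS //.
(* The image of the nilpotent F(G) is a normal p-subgroup, hence lies in the Sylow subgroup [S] of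
   the quotient. *)
rewrite pcore_max ?quotient_normal ?Fitting_normal //.
by rewrite quotient_pcoreC_pgroup ?Fitting_normal ?Fitting_nil.
Qed.
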